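(* For every positive integer $n$, \[ \sum_{w\in \mathrm{FC}(B_n)} \mathbf{x}^{\mathrm{Des}_B(w)}\,\mathbf{z}^{\mathrm{Neg}(w)}\,q^{\mathrm{bl}(w^{-1})}\,t^{\,n-\mathrm{ldes}(w^{-1})} =\sum_{w\in \mathrm{FC}(B_n)} \mathbf{x}^{\mathrm{Des}_B(w)}\,\mathbf{z}^{\mathrm{Neg}(w)}\,q^{\,n-\mathrm{ldes}(w^{-1})}\,t^{\mathrm{bl}(w^{-1})}. \]
   Context: $B_n$ is the group of signed permutations of $\{\pm1,\ldots,\pm n\}$ ($w(-i)=-w(i)$), written $w=[w_1,\ldots,w_n]$, composed as functions. Coxeter generators: $s_0=[-1,2,\ldots,n]$, $s_i=[1,\ldots,i-1,i+1,i,i+2,\ldots,n]$ ($1\le i\le n-1$). An element is fully commutative (FC) if any reduced expression in these generators can be obtained from any other using only commutation relations $st=ts$ between commuting generators; $\mathrm{FC}(B_n)$ is the set of FC elements. With $w_0:=0$: $\mathrm{Des}_B(w)=\{0\le i\le n-1\mid w_i>w_{i+1}\}$; $\mathrm{ldes}(w)=\max\mathrm{Des}_B(w)$ (or $0$ if empty); $\mathrm{Neg}(w)=\{i\in[n]\mid w_i<0\}$; $\mathrm{bl}(w)=1+\#\{1\le i\le n-1\mid \max(w_1,\ldots,w_i)<\min(w_{i+1},\ldots,w_n)\}$. For a set $J$, $\mathbf{x}^J=\prod_{i\in J}x_i$, and similarly $\mathbf{z}^J$. *)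

(* Defs.v *)
From HB Require Import structures.
From mathcomp Require Import all_boot all_order all_algebra all_fingroup.
From Stdlib Require Import Relations.
Set Implicit Arguments. Unset Strict Implicit. Unset Printing Implicit Defensive.
Import Order.TTheory GRing.Theory Num.Theory.

(* Signed permutations of {+-1,...,+-n}: a pair (sigma, eps) represents
   w with w(i+1) = (-1)^(eps i) * (sigma i + 1)  (0-indexed positions i). *)
Definition spn (n : nat) : finType := ('S_n * {ffun 'I_n -> bool})%type.

Section SignedPerm.
Variable n : nat.

(* w_{i+1} for the 0-indexed position i *)
Definition spval (w : spn n) (i : 'I_n) : int :=
  ((if w.2 i then -1 else 1) * (Posz (w.1 i).+1))%R.

(* composition as functions: (spcomp u v)(i) = u (v i) *)
Definition spcomp (u v : spn n) : spn n :=
  ((v.1 * u.1)%g, [ffun i => v.2 i (+) u.2 (v.1 i)]).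

Definition spinv (w : spn n) : spn n :=
  ((w.1^-1)%g, [ffun j => w.2 ((w.1^-1)%g j)]).

Definition sp1 : spn n := (1%g, [ffun => false]).

Definition ordpred (k : 'I_n) : 'I_n :=
  Ordinal (leq_ltn_trans (leq_pred k) (ltn_ord k)).

(* Coxeter generators: gen 0 = s_0 = [-1,2,...,n];
   gen k (k >= 1) = s_k exchanging positions k and k+1. *)
Definition gen (k : 'I_n) : spn n :=
  if (k : nat) == 0 then (1%g, [ffun i : 'I_n => (i : nat) == 0])
  else (tperm (ordpred k) k, [ffun => false]).

Definition wordprod (s : seq 'I_n) : spn n :=
  foldr (fun k acc => spcomp (gen k) acc) sp1 s.

Definition reduced_word (w : spn n) (s : seq 'I_n) : Prop :=
  wordprod s = w /\ forall s' : seq 'I_n, wordprod s' = w -> size s <= size s'.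

Definition comm_step (s1 s2 : seq 'I_n) : Prop :=
  exists (a b : seq 'I_n) (x y : 'I_n),
    spcomp (gen x) (gen y) = spcomp (gen y) (gen x) /\
    s1 = a ++ x :: y :: b /\ s2 = a ++ y :: x :: b.

Definition fully_commutative (w : spn n) : Prop :=
  forall s1 s2 : seq 'I_n, reduced_word w s1 -> reduced_word w s2 ->
    clos_refl_trans (seq 'I_n) comm_step s1 s2.

(* one-line notation with w_0 := 0: wv w i = w_i for 0 <= i <= n *)
Definition wv (w : spn n) (i : nat) : int :=
  nth 0%R (0%R :: [seq spval w j | j <- enum 'I_n]) i.

Definition DesB (w : spn n) (i : nat) : bool := (i < n) && (wv w i.+1 < wv w i)%R.

Definition ldes (w : spn n) : nat := \max_(0 <= i < n | DesB w i) i.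

Definition Neg (w : spn n) (i : nat) : bool := (1 <= i <= n) && (wv w i < 0)%R.

Definition bl (w : spn n) : nat :=
  1 + \sum_(1 <= i < n)
        ((\big[Num.max/wv w 1]_(1 <= j < i.+1) wv w j)
           < (\big[Num.min/wv w n]_(i.+1 <= j < n.+1) wv w j))%R.

End SignedPerm.

Definition monoDes (R : comNzRingType) n (x : nat -> R) (w : spn n) : R :=
  (\prod_(0 <= i < n | DesB w i) x i)%R.
Definition monoNeg (R : comNzRingType) n (z : nat -> R) (w : spn n) : R :=
  (\prod_(1 <= i < n.+1 | Neg w i) z i)%R.

(* Main.v *)
Require Import Defs.
From HB Require Import structures.
From mathcomp Require Import all_boot all_order all_algebra all_fingroup.
From mathcomp Require Import zify ring.
From Stdlib Require Import Relations.
Set Implicit Arguments. Unset Strict Implicit. Unset Printing Implicit Defensive.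
Import Order.TTheory GRing.Theory Num.Theory.

(* Put v = w^-1. An element w is fully commutative iff v avoids certain patterns
   of three entries of the window v_{-n} ... v_n: by induction on the length, a
   pattern can be preserved along some descent of v until v has two adjacent
   descents, i.e. until a reduced word of w begins with a full braid.
   Fix the set Neg(w). Standardizing v gives a permutation p of S_n with the same
   bl and ldes; w is fully commutative iff p avoids 321 and certain inverse
   descents of p are absent, and then Des_B(w) depends only on the inverse descent
   set of p. So everything follows from the symmetry of (bl(p), n - ldes(p)) over
   the 321-avoiding p with a prescribed inverse descent set.
   Build p by inserting 1, ..., n in turn. If u_1 < u_2 < ... are the values after
   which an entry is inserted elsewhere than at the end, and v_j <= u_j is the
   one-based position of that insertion, then 321-avoidance says v_1 < v_2 < ...,
   ldes is the last v_j, bl counts the points of [n] in no interval [v_j, u_j],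
   and the inverse descent set is determined by the u_j. For fixed (u_j) the
   generating polynomial X(u_1, u_2, ...) satisfies
   X(u_1 + 1, u_2, ...) = X(u_1, u_2, ...) + X'(u_2, ...), where X' is the
   polynomial with origin moved to u_1 + 1, so it is symmetric by induction. *)

(** * The symmetric recursion *)

Section CodeSums.
Local Open Scope ring_scope.
Variables (R : comNzRingType) (n : nat).

(* The sum over lo < v_1 < v_2 < ... with v_j <= u_j of q^(number of points of
   (u0, n] in no interval [v_j, u_j]) t^(n - last v). The bound variable below is
   v_j - 1. *)
Fixpoint code_gf (q t : R) (lo u0 : nat) (us : seq nat) : R :=
  if us is u :: us' then
    \sum_(lo <= v < u) q ^+ (v - u0) * code_gf q t v.+1 u us'
  else q ^+ (n - u0) * t ^+ (n - lo).

(** Only the first factor sees the origin. For v <= u truncated subtraction gives exponent 0 either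
    way; for v > u the exponent drops by one, and q = 1 + (q - 1) accounts for the difference. *)
Lemma code_gf_shift (q t : R) lo u u2 us : (lo <= u.+1)%N -> (u < u2)%N ->
  code_gf q t lo u (u2 :: us) =
  code_gf q t lo u.+1 (u2 :: us) + (q - 1) * code_gf q t u.+1 u.+1 (u2 :: us).
Proof.
move=> hlo hu /=.
rewrite (big_cat_nat hlo hu) /= [in X in _ = X + _](big_cat_nat hlo hu) /=.
rewrite -addrA; congr (_ + _).
  apply: eq_big_nat => v /andP[_ hv].
  by congr (_ ^+ _ * _); lia.
rewrite mulr_sumr -big_split /=; apply: eq_big_nat => v /andP[hv _].
have -> : (v - u = (v - u.+1).+1)%N by lia.
by rewrite exprS; ring.
Qed.

(** The new top term gives q^(u - a) Y, while shifting the other terms costs (q - 1) times a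
    geometric series, that is (q^(u - a) - 1) Y. The difference is Y with no stray power of [q] or
    [t], so symmetry passes through. *)
Lemma code_gf_rec (q t : R) a u u2 us : (a <= u)%N -> (u.+1 < u2)%N ->
  code_gf q t a a (u.+1 :: u2 :: us) =
  code_gf q t a a (u :: u2 :: us) + code_gf q t u.+1 u.+1 (u2 :: us).
Proof.
move=> hau hu.
have E (u' : nat) us' : code_gf q t a a (u' :: us') =
  \sum_(a <= v < u') q ^+ (v - a) * code_gf q t v.+1 u' us' by [].
rewrite !E big_nat_recr //= -/(code_gf q t u.+1 u.+1 (u2 :: us)).
set Y := code_gf q t u.+1 u.+1 (u2 :: us).
have -> : \sum_(a <= v < u) q ^+ (v - a) * code_gf q t v.+1 u (u2 :: us) =
   \sum_(a <= v < u) q ^+ (v - a) * code_gf q t v.+1 u.+1 (u2 :: us) +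
   \sum_(a <= v < u) (q - 1) * q ^+ (v - a) * Y.
  rewrite -big_split /=; apply: eq_big_nat => v /andP[_ hv].
  rewrite -/(code_gf q t v.+1 u (u2 :: us)) code_gf_shift; [|lia|lia].
  rewrite -/Y -/(code_gf q t v.+1 u.+1 (u2 :: us)); ring.
rewrite -mulr_suml -mulr_sumr.
have -> : (q - 1) * \sum_(a <= v < u) q ^+ (v - a) = q ^+ (u - a) - 1.
  rewrite -{1}[a]add0n big_addn big_mkord subrX1; congr (_ * _).
  by apply: eq_bigr => i _; rewrite addnK.
by rewrite -/(code_gf q t _ _ _); ring.
Qed.

(** Double induction, on the length of [us] and then on its first entry along [code_gf_rec], down to
    the point where both sums are empty. *)
Lemma code_gf_sym (q t : R) a us : path leq a us -> sorted ltn us -> all (leq^~ n) us ->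
  code_gf q t a a us = code_gf t q a a us.
Proof.
elim: us a => [|u [|u2 us] IH] a; first by rewrite /= mulrC.
  move=> /= /andP[hau _] _ /andP[hun _].
  (* With a single interval, v -> a + u - 1 - v exchanges the exponents v - a and u - 1 - v; the
     part n - u occurs for both [q] and [t]. *)
  rewrite [RHS]big_nat_rev /=; apply: eq_big_nat => v /andP[hav hv].
  have -> : ((a + u - v.+1) - a = u - v.+1)%N by lia.
  have -> : (n - v.+1 = (n - u) + (u - v.+1))%N by lia.
  have -> : (n - (a + u - v.+1).+1 = (n - u) + (v - a))%N by lia.
  by rewrite !exprD; ring.
move=> /andP[]; elim: u => [|u IHu] hau hp hs ha.
  by rewrite /= !big_geq.
case: (leqP a u) => [hau'|hua]; last by rewrite /= !big_geq.
have [hu hs2] : (u.+1 < u2)%N /\ sorted ltn (u2 :: us) by move: hs => /= /andP[].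
have ha2 : all (leq^~ n) (u2 :: us) by move: ha => /= /andP[].
have hp2 : path leq u2 us by move: hp => /= /andP[].
have hs' : sorted ltn (u :: u2 :: us) by move: hs2 => /= ->; rewrite andbT; lia.
have hp' : path leq u (u2 :: us) by rewrite /= hp2 andbT; lia.
have ha' : all (leq^~ n) (u :: u2 :: us) by move: ha => /= /andP[h ->]; rewrite andbT; lia.
rewrite !code_gf_rec // IHu //; congr (_ + _).
by apply: IH => //=; rewrite hp2 andbT ltnW.
Qed.
End CodeSums.

(** * Insertion of the largest value into a permutation *)

Section PermStats.
Variable n : nat.
Implicit Type p : 'S_n.

Definition av321 p := [forall a : 'I_n, forall b : 'I_n, forall c : 'I_n,
  ~~ [&& a < b, b < c, p c < p b & p b < p a]].
(** A threshold form of [ldes]: with zero-based positions it holds exactly when [ldes] is at most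
    [m]. *)
Definition inc_from p m := [forall a : 'I_n, forall b : 'I_n,
  (m <= a < b) ==> (p a < p b)].
Definition perm_cut p m := [forall a : 'I_n, forall b : 'I_n,
  (a < m <= b) ==> (p a < p b)].
Definition inv_des p i := [exists a : 'I_n, exists b : 'I_n,
  [&& a < b, p a == i.+1 :> nat & p b == i :> nat]].

Lemma av321P p : reflect (forall a b c : 'I_n, a < b -> b < c -> p c < p b -> p b < p a -> False)
  (av321 p).
Proof.
apply: (iffP forallP) => [h a b c h1 h2 h3 h4|h a].
  by move/forallP/(_ b)/forallP/(_ c)/negP: (h a); apply; rewrite h1 h2 h3 h4.
apply/forallP => b; apply/forallP => c; apply/negP => /and4P[h1 h2 h3 h4].
exact: (h a b c).
Qed.

Lemma inc_fromP p m : reflect (forall a b : 'I_n, m <= a -> a < b -> p a < p b) (inc_from p m).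
Proof.
apply: (iffP forallP) => [h a b h1 h2|h a].
  by move/forallP/(_ b)/implyP: (h a); apply; rewrite h1 h2.
by apply/forallP => b; apply/implyP => /andP[h1 h2]; apply: h.
Qed.

Lemma perm_cutP p m : reflect (forall a b : 'I_n, a < m -> m <= b -> p a < p b) (perm_cut p m).
Proof.
apply: (iffP forallP) => [h a b h1 h2|h a].
  by move/forallP/(_ b)/implyP: (h a); apply; rewrite h1 h2.
by apply/forallP => b; apply/implyP => /andP[h1 h2]; apply: h.
Qed.

Lemma inv_desP p i : reflect (exists a b : 'I_n, [/\ a < b, p a = i.+1 :> nat & p b = i :> nat])
  (inv_des p i).
Proof.
apply: (iffP existsP) => [[a /existsP[b /and3P[h /eqP h1 /eqP h2]]]|[a [b [h h1 h2]]]].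
  by exists a, b.
by exists a; apply/existsP; exists b; rewrite h h1 h2 !eqxx.
Qed.
End PermStats.

Section Insertion.
Variable n : nat.
Implicit Types (p : 'S_n) (v : 'I_n.+1).

Definition ins_max p v : 'S_n.+1 := lift_perm v ord_max p.

Lemma ins_max_id p v : ins_max p v v = n :> nat.
Proof. by rewrite lift_perm_id. Qed.

Lemma ins_max_lift p v k : ins_max p v (lift v k) = p k :> nat.
Proof. by rewrite lift_perm_lift lift_max. Qed.

Lemma lift_val (v : 'I_n.+1) (k : 'I_n) : lift v k = (v <= k) + k :> nat.
Proof. by []. Qed.

Lemma lift_cases v (a : 'I_n.+1) : {k : 'I_n | a = lift v k} + {a = v}.
Proof. by case: (unliftP v a) => [k ->|->]; [left; exists k | right]. Qed.

(** The inserted maximum can only be the largest entry of a 321 pattern, so what has to be excluded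
    is an inversion to its right. *)
Lemma av321_ins p v : av321 (ins_max p v) = av321 p && inc_from p v.
Proof.
apply/idP/andP => [/av321P h|[/av321P h /inc_fromP hv]]; last first.
  apply/av321P => a b c.
  case: (lift_cases v b) => [[b' ->]|->]; last by rewrite ins_max_id; have := ltn_ord (ins_max p v a); lia.
  case: (lift_cases v c) => [[c' ->]|->]; last first.
    by rewrite ins_max_id; have := ltn_ord (ins_max p v (lift v b')); lia.
  case: (lift_cases v a) => [[a' ->]|->]; rewrite ?ins_max_id !ins_max_lift !lift_val => h1 h2 h3 h4.
    by apply: (h a' b' c') => //; lia.
  by have := hv b' c'; lia.
split.
  apply/av321P => a b c h1 h2 h3 h4.
  by apply: (h (lift v a) (lift v b) (lift v c)); rewrite ?ins_max_lift ?lift_val //; lia.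
apply/inc_fromP => a b h1 h2; rewrite ltnNge leq_eqVlt; apply/negP => /orP[|hba].
  by rewrite (inj_eq val_inj) (inj_eq perm_inj) => /eqP E; move: h2; rewrite E ltnn.
apply: (h v (lift v a) (lift v b)); rewrite ?ins_max_lift ?ins_max_id ?lift_val //; lia.
Qed.

(** A maximum inserted before the end creates a descent just after position [v], the last one
    because [p] increases from [v]. *)
Lemma inc_from_ins p v m : inc_from p v ->
  inc_from (ins_max p v) m = if v == n :> nat then inc_from p m else v < m.
Proof.
move=> /inc_fromP hv; case: eqP => hvn.
  apply/inc_fromP/inc_fromP => h a b.
    move=> h1 h2; have := h (lift v a) (lift v b).
    by rewrite !ins_max_lift !lift_val; have := ltn_ord a; have := ltn_ord b; lia.
  case: (lift_cases v a) => [[a' ->]|->]; last by have := ltn_ord b; lia.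
  case: (lift_cases v b) => [[b' ->]|->]; rewrite ?ins_max_id !ins_max_lift.
    by rewrite !lift_val => h1 h2; apply: h; move: h1 h2; have := ltn_ord a'; have := ltn_ord b'; lia.
  by move=> *; exact: ltn_ord.
have hv' : v < n by have := ltn_ord v; lia.
apply/inc_fromP/idP => [h|hm a b].
  rewrite ltnNge; apply/negP => hm.
  have := h v (lift v (Ordinal hv')); rewrite ins_max_id ins_max_lift lift_val /=.
  by have := ltn_ord (p (Ordinal hv')); lia.
case: (lift_cases v a) => [[a' ->]|->]; last lia.
case: (lift_cases v b) => [[b' ->]|->]; rewrite ?ins_max_id !ins_max_lift ?lift_val; last lia.
by move=> h1 h2; apply: hv; lia.
Qed.

(** The maximum has to lie to the right of the cut. At the end it always does, and it also creates
    the cut m = n. *)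
Lemma perm_cut_ins p v m : m <= n ->
  perm_cut (ins_max p v) m = if v == n :> nat then (m == n) || perm_cut p m else (m <= v) && perm_cut p m.
Proof.
move=> hmn; case: eqP => hvn.
  case: eqP => [->|hm] /=.
    apply/perm_cutP => a b ha hb.
    have -> : b = v by apply: val_inj => /=; have := ltn_ord b; lia.
    case: (lift_cases v a) ha => [[a' ->]|->] ha; last lia.
    by rewrite ins_max_id ins_max_lift.
  apply/perm_cutP/perm_cutP => h a b.
    move=> h1 h2; have := h (lift v a) (lift v b).
    by rewrite !ins_max_lift !lift_val; have := ltn_ord a; have := ltn_ord b; lia.
  case: (lift_cases v a) => [[a' ->]|->]; last lia.
  case: (lift_cases v b) => [[b' ->]|->]; rewrite ?ins_max_id !ins_max_lift // ?lift_val.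
  by move=> h1 h2; apply: h; move: h1 h2; have := ltn_ord a'; have := ltn_ord b'; lia.
have hv' : v < n by have := ltn_ord v; lia.
apply/perm_cutP/andP => [h|[hm /perm_cutP h] a b].
  have hm : m <= v.
    rewrite leqNgt; apply/negP => hm.
    have hn : n.-1 < n by lia.
    have := h v (lift v (Ordinal hn)) hm; rewrite ins_max_id ins_max_lift lift_val /=.
    by have := ltn_ord (p (Ordinal hn)); lia.
  split=> //; apply/perm_cutP => a b h1 h2.
  by have := h (lift v a) (lift v b); rewrite !ins_max_lift !lift_val; lia.
case: (lift_cases v a) => [[a' ->]|->]; last lia.
case: (lift_cases v b) => [[b' ->]|->]; rewrite ?ins_max_id !ins_max_lift ?lift_val //.
by move=> h1 h2; apply: h; lia.
Qed.

(** Only the pair of the old and the new maximum is new. As [p] increases from [v], the old maximum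
    can follow the new one only as the last entry of [p]; this is phrased as a cut because codes
    describe cuts. *)
Lemma inv_des_ins p v i : inc_from p v -> inv_des (ins_max p v) i =
  if i.+1 == n then (v < n) && ((n == 1) || perm_cut p n.-1) else inv_des p i.
Proof.
move=> /inc_fromP hv; case: eqP => hi; last first.
  apply/inv_desP/inv_desP => [[a [b []]]|[a [b [h1 h2 h3]]]].
    case: (lift_cases v a) => [[a' ->]|->]; rewrite ?ins_max_id ?ins_max_lift; last lia.
    case: (lift_cases v b) => [[b' ->]|->]; rewrite ?ins_max_id ?ins_max_lift ?lift_val.
      by move=> h1 h2 h3; exists a', b'; split=> //; lia.
    by move=> _; have := ltn_ord (p a'); lia.
  by exists (lift v a), (lift v b); rewrite !ins_max_lift !lift_val; split=> //; lia.
have hlast : n.-1 < n by lia.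
have hpi : p ((p^-1)%g (Ordinal hlast)) = i :> nat by rewrite permKV /=; lia.
move: hpi; set k := (p^-1)%g _ => hpk.
have -> : inv_des (ins_max p v) i = (v <= k).
  apply/inv_desP/idP => [[a [b []]]|hvk].
    case: (lift_cases v a) => [[a' ->]|->]; rewrite ?ins_max_id ?ins_max_lift.
      by have := ltn_ord (p a'); lia.
    case: (lift_cases v b) => [[b' ->]|->]; rewrite ?ins_max_id ?ins_max_lift ?lift_val; last lia.
    move=> h1 _ h3; have -> : k = b' by apply: (@perm_inj _ p); apply: val_inj; rewrite /= hpk h3.
    by lia.
  by exists v, (lift v k); rewrite ins_max_id ins_max_lift lift_val; split => //; lia.
have hcut : ((n == 1) || perm_cut p n.-1) = (k == n.-1 :> nat).
  have [hn1|hn1] := eqVneq n 1; first by have := ltn_ord k; lia.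
  apply/perm_cutP/eqP => [h|hk a b h1 h2].
    have := ltn_ord k; have := h k (Ordinal hlast); rewrite /= => h' h''.
    by have := ltn_ord (p (Ordinal hlast)); move: h' h''; rewrite hpk; lia.
  have -> : b = k by apply: val_inj => /=; have := ltn_ord b; lia.
  have : p a != p k :> nat by rewrite (inj_eq val_inj) (inj_eq perm_inj) -(inj_eq val_inj) /=; lia.
  by have := ltn_ord (p a); rewrite hpk; lia.
rewrite hcut; apply/idP/andP => [hvk|[hvn /eqP hk]]; last by lia.
have := ltn_ord k; split; first by lia.
apply/eqP; apply/eqP; rewrite eqn_leq; apply/andP; split; first by lia.
rewrite leqNgt; apply/negP => hk.
have := hv k (Ordinal hlast) hvk hk; rewrite hpk.
by have := ltn_ord (p (Ordinal hlast)); lia.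
Qed.

(** The position of the maximum recovers [v], and (n + 1) n! = (n + 1)! does the rest. *)
Lemma ins_max_bij : bijective (fun x : 'I_n.+1 * 'S_n => ins_max x.2 x.1).
Proof.
apply: inj_card_bij => [[v p] [v' p'] /= E|]; last first.
  by rewrite card_prod card_ord !card_Sn factS.
have hv : v = v'.
  apply: (@perm_inj _ (ins_max p v)); rewrite [in RHS]E.
  by apply: val_inj; rewrite /= !ins_max_id.
move: E; rewrite -hv => E; congr (_, _); apply/permP => k; apply: val_inj => /=.
by rewrite -(ins_max_lift p v) E ins_max_lift.
Qed.
End Insertion.

(** * The symmetry for 321-avoiding permutations *)

Lemma sorted_rcons_ltn (s : seq nat) x :
  sorted ltn s -> all (ltn^~ x) s -> sorted ltn (rcons s x).
Proof.
case: s => //= y s hs /andP[hy ha]; rewrite rcons_path hs /=.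
have := mem_last y s; rewrite inE => /predU1P[->//|h].
by move/allP: ha; apply.
Qed.

(** * Sums over insertion codes *)

Section CodeSums.
Local Open Scope ring_scope.
Variable R : comNzRingType.

Fixpoint sum_pos (lo : nat) (us : seq nat) (h : seq nat -> R) : R :=
  if us is u :: us' then
    \sum_(lo <= v < u) sum_pos v.+1 us' (fun vs => h (v.+1 :: vs))
  else h [::].

(** Sums over increasing lists with entries below [n], built by appending the largest entry to match
    insertion. A list starting with 0 contributes nothing to the later sums, as no v_1 satisfies 1
    <= v_1 <= 0. *)
Fixpoint sum_sub (n : nat) (k : seq nat -> R) : R :=
  if n is n'.+1 then sum_sub n' k + sum_sub n' (fun us => k (rcons us n')) else k [::].

Lemma eq_sum_pos lo us h h' : (forall vs, h vs = h' vs) -> sum_pos lo us h = sum_pos lo us h'.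
Proof.
elim: us lo h h' => [|u us IH] lo h h' E /=; first exact: E.
by apply: eq_bigr => v _; apply: IH => vs.
Qed.

Lemma sum_posD lo us h h' :
  sum_pos lo us (fun vs => h vs + h' vs) = sum_pos lo us h + sum_pos lo us h'.
Proof.
elim: us lo h h' => [|u us IH] lo h h' //=.
by rewrite -big_split /=; apply: eq_bigr => v _; rewrite IH.
Qed.

Lemma sum_posZ lo us c h : sum_pos lo us (fun vs => c * h vs) = c * sum_pos lo us h.
Proof.
elim: us lo h => [|u us IH] lo h //=.
by rewrite mulr_sumr; apply: eq_bigr => v _; rewrite IH.
Qed.

(** Insertion adds the last interval, whereas [sum_pos] and [code_gf] unfold from the first. *)
Lemma sum_pos_rcons lo us u h : sum_pos lo (rcons us u) h =
  sum_pos lo us (fun vs => \sum_(last lo vs <= v < u) h (rcons vs v.+1)).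
Proof.
elim: us lo h => [|u' us IH] lo h //=.
by apply: eq_bigr => v _; rewrite IH.
Qed.

Lemma eq_sum_sub n k k' :
  (forall us, sorted ltn us -> all (ltn^~ n) us -> k us = k' us) -> sum_sub n k = sum_sub n k'.
Proof.
elim: n k k' => [|n IH] k k' E /=; first exact: E.
congr (_ + _); apply: IH => us hs ha; apply: E => //.
- by apply: sub_all ha => u /=; lia.
- exact: sorted_rcons_ltn.
- by rewrite all_rcons /= ltnSn; apply: sub_all ha => u /=; lia.
Qed.

Lemma sum_subD n k k' :
  sum_sub n (fun us => k us + k' us) = sum_sub n k + sum_sub n k'.
Proof.
by elim: n k k' => [|n IH] k k' //=; rewrite !IH addrACA.
Qed.
End CodeSums.

(** * Codes of 321-avoiding permutations *)

Definition uncovered (p : nat) (us vs : seq nat) :=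
  all (fun x : nat * nat => (x.1 < p) || (p < x.2)) (zip us vs).

(* [us] are the u_j and [vs] the v_j of the permutation [p]. *)
Record code_of n (us vs : seq nat) (p : 'S_n) : Prop := CodeOf {
  code_size : size us = size vs;
  code_us : sorted ltn us;
  code_vs : path ltn 0 vs;
  code_range : all (fun x : nat * nat => (0 < x.2) && (x.2 <= x.1 < n)) (zip us vs);
  code_inc : forall m, inc_from p m = (last 0 vs <= m);
  code_cut : forall m, 0 < m < n -> perm_cut p m = uncovered m us vs;
  code_inv_des : forall i, inv_des p i = (i.+1 \in us) && (i \notin us) }.

Lemma code_us_range n us vs (p : 'S_n) : code_of us vs p -> forall u, u \in us -> 0 < u < n.
Proof.
case=> hs _ _ hr _ _ _ u hu.
have : u \in unzip1 (zip us vs) by rewrite unzip1_zip ?hs.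
by case/mapP => x /(allP hr) h ->; lia.
Qed.

(** Nothing is recorded when the maximum goes to the end: every u_j is below [n], so the new cut m =
    n is uncovered. *)
Lemma code_append n us vs (p : 'S_n) : code_of us vs p -> code_of us vs (ins_max p ord_max).
Proof.
move=> hc; have hur := code_us_range hc; case: hc => hs hu hv hr hi hcut hd.
have hif : inc_from p (ord_max : 'I_n.+1) by apply/inc_fromP => a b /=; have := ltn_ord a; lia.
split=> //.
- by apply: sub_all hr => x; lia.
- by move=> m; rewrite inc_from_ins //= eqxx.
- move=> m hm; rewrite perm_cut_ins ?eqxx; last by lia.
  case: eqP => [->|hmn] /=; last by apply: hcut; lia.
  by symmetry; apply: sub_all hr => x; lia.
- move=> i; rewrite inv_des_ins //= ltnn /=; case: eqP => // ->.
  by case: (boolP (n \in us)) => // /hur; rewrite ltnn andbF.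
Qed.

Lemma code_insert n us vs (p : 'S_n) (v : 'I_n.+1) : code_of us vs p ->
  v < n -> last 0 vs <= v -> code_of (rcons us n) (rcons vs v.+1) (ins_max p v).
Proof.
move=> hc; have hur := code_us_range hc; case: hc => hs hu hv hr hi hcut hd hvn hlast.
have hif : inc_from p v by rewrite hi.
have hvn' : (v == n :> nat) = false by lia.
have hnu : n \notin us by apply/negP => /hur; lia.
split.
- by rewrite !size_rcons hs.
- by apply: sorted_rcons_ltn => //; apply/allP => u /hur /=; lia.
- by rewrite rcons_path hv.
- by rewrite zip_rcons // all_rcons /= !ltnSn hvn /=; apply: sub_all hr => x; lia.
- by move=> m; rewrite inc_from_ins // hvn' last_rcons.
- move=> m hm; rewrite perm_cut_ins ?hvn' /uncovered ?zip_rcons ?all_rcons //=; last by lia.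
  have -> : (n < m) || (m < v.+1) = (m <= v) by lia.
  by case: (leqP m v) => //= hmv; apply: hcut; lia.
- move=> i; rewrite inv_des_ins // hvn /= hd !mem_rcons !inE.
  have [hin|hin] := eqVneq i.+1 n; last first.
    have [->|//] := eqVneq i n.
    rewrite /= andbF; have -> // : (n.+1 \in us) = false by apply/negP => /hur; lia.
  have -> : (i == n) = false by lia.
  rewrite /=; case: (eqVneq n 1) => [hn1|hn1] /=.
    by case: (boolP (i \in us)) => // /hur; lia.
  have -> : n.-1 = i by lia.
  (* All u_j are below [n], so the point i = n - 1 is covered exactly when some u_j equals it; the
     cut condition becomes the absence of [i] from [us]. *)
  rewrite hcut; last by lia.
  apply/idP/idP => [h|/negP h].
    apply/negP => hiu; have : i \in unzip1 (zip us vs) by rewrite unzip1_zip ?hs.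
    by case/mapP => x hx hix; move/allP: h => /(_ x hx); move/allP: hr => /(_ x hx); lia.
  apply/allP => -[x y] hx.
  have hxu : x \in us by rewrite -(@unzip1_zip _ _ us vs) ?hs //; exact: (map_f fst hx).
  have := hur _ hxu; have /= : x != i by apply/eqP => E; apply: h; rewrite -E.
  by lia.
Qed.

Section SumAv.
Local Open Scope ring_scope.
Variable R : comNzRingType.

(** Each [p] contributes one term for appending the maximum and one for every position from
    [last 0 vs] to n - 1, which is how [sum_sub] and [sum_pos] grow. *)
Lemma sum_av321 n (f : 'S_n -> R) (g : seq nat -> seq nat -> R) :
  (forall p us vs, code_of us vs p -> f p = g us vs) ->
  \sum_(p | av321 p) f p = sum_sub n (fun us => sum_pos 0 us (g us)).
Proof.
elim: n f g => [|n IH] f g E.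
  rewrite /= (big_pred1 1%g) => [|p]; last first.
    have -> : p = 1%g by apply/permP; case.
    by rewrite /= eqxx; apply/av321P; case.
  apply: E; split=> // [m|m|i]; [by apply/inc_fromP; case | lia |].
  by rewrite !in_nil; apply/inv_desP => -[[]].
rewrite (reindex _ (onW_bij _ (ins_max_bij n))) /=.
under eq_bigl => x do rewrite av321_ins.
rewrite -(pair_big_dep xpredT (fun (v : 'I_n.+1) (p : 'S_n) => av321 p && inc_from p v)
   (fun (v : 'I_n.+1) (p : 'S_n) => f (ins_max p v))) /=.
rewrite (exchange_big_dep (fun p : 'S_n => av321 p)) => [|v p _ /andP[]//] /=.
rewrite (eq_bigr (fun p => \sum_(v : 'I_n.+1 | inc_from p v) f (ins_max p v))); last first.
  by move=> p hp; apply: eq_bigl => v; rewrite hp.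
rewrite (IH _ (fun us vs => g us vs + \sum_(last 0%N vs <= v < n) g (rcons us n) (rcons vs v.+1))).
  rewrite -sum_subD; apply: eq_sum_sub => us _ _.
  by rewrite sum_posD sum_pos_rcons.
move=> p us vs hc.
rewrite big_mkcond big_ord_recr /= (E _ _ _ (code_append hc)).
have -> : inc_from p n by apply/inc_fromP => a b; have := ltn_ord a; lia.
rewrite addrC; congr (_ + _) => //; rewrite big_geq_mkord [RHS]big_mkcond /=.
apply: eq_bigr => i _; rewrite (code_inc hc) /=; case: leqP => // hi.
by apply: E; apply: (@code_insert _ _ _ _ (widen_ord (leqnSn n) i)) => //=; exact: ltn_ord.
Qed.
End SumAv.

(** The exponent of [q] in [code_gf]. Truncated subtraction gives 0 before an interval that meets
    its predecessor. *)
Fixpoint gaps (n u0 : nat) (us vs : seq nat) : nat :=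
  if us is u :: us' then
    if vs is v :: vs' then (v.-1 - u0) + gaps n u us' vs' else n - u0
  else n - u0.

Lemma code_gf_sum_pos (R : comNzRingType) n (q t : R) lo u0 us :
  (code_gf n q t lo u0 us =
   sum_pos lo us (fun vs => q ^+ gaps n u0 us vs * t ^+ (n - last lo vs)))%R.
Proof.
elim: us lo u0 => [|u us IH] lo u0 //=.
apply: eq_bigr => v _; rewrite IH -sum_posZ; apply: eq_sum_pos => vs.
by rewrite exprD mulrA.
Qed.

(** Up to u_1 the later intervals cover nothing more, since v_1 is the least left end; beyond u_1
    the first interval is out of reach. *)
Lemma sum_uncovered n u0 us vs : size us = size vs -> path leq u0 us -> all (leq^~ n) us ->
  u0 <= n -> sorted ltn vs -> all (fun x : nat * nat => 0 < x.2 <= x.1) (zip us vs) ->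
  \sum_(u0.+1 <= m < n.+1) uncovered m us vs = gaps n u0 us vs.
Proof.
elim: us u0 vs => [|u us IH] u0 [|v vs] //=.
  by move=> _ _ _ _ _ _; rewrite /uncovered /= sum_nat_const_nat muln1.
move=> [hs] /andP[hu hp] /andP[hun ha] hu0 hv /andP[hvu hz].
rewrite (big_cat_nat (n := u.+1)) //=; congr (_ + _).
  have E m : u0.+1 <= m < u.+1 -> uncovered m (u :: us) (v :: vs) = (m < v) :> nat.
    move=> hm; rewrite /uncovered /= ltnNge; have -> : m <= u by lia.
    case: (ltnP m v) => //= hmv; rewrite (_ : all _ _) //; apply/allP => -[x y] hxy /=.
    have hy : y \in vs by rewrite -(@unzip2_zip _ _ us vs) ?hs //; exact: (map_f snd hxy).
    by have /allP/(_ _ hy) := order_path_min ltn_trans hv; lia.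
  rewrite (eq_big_nat _ _ E); case: (leqP v u0.+1) => hv0.
    rewrite big_nat big1 => [|m hm]; last by lia.
    by lia.
  rewrite (big_cat_nat (n := v)) //=; [|lia|lia].
  rewrite [X in X + _](_ : _ = \sum_(u0.+1 <= m < v) 1); last by apply: eq_big_nat => m hm; lia.
  rewrite [X in _ + X]big_nat [X in _ + X]big1 => [|m hm]; last by lia.
  by rewrite sum_nat_const_nat; lia.
rewrite -IH //; last by move: hv; case: (vs) => //= y s /andP[].
by apply: eq_big_nat => m hm; rewrite /uncovered /=; have -> : u < m by lia.
Qed.

Section TypeA.
Local Open Scope ring_scope.
Variables (R : comNzRingType) (n : nat).

Definition perm_bl (p : 'S_n) : nat := (1 + \sum_(1 <= m < n) perm_cut p m)%N.

Lemma perm_bl_code us vs (p : 'S_n) : (0 < n)%N -> code_of us vs p -> perm_bl p = gaps n 0 us vs.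
Proof.
move=> hn hc; have hur := code_us_range hc; case: hc => hs hu hv hr _ hcut _.
rewrite -sum_uncovered //.
(* The point m = n lies beyond all u_j and accounts for the leading 1 in [perm_bl]. *)
- rewrite big_nat_recr //= addnC; congr (_ + _)%N.
    rewrite (_ : uncovered _ _ _ = true) //.
    by apply: sub_all hr => x; lia.
  by apply: eq_big_nat => m hm; rewrite hcut.
- have : sorted leq us by apply: sub_sorted hu => x y /ltnW.
  by case: (us) => //= u s ->.
- by apply/allP => u /hur /=; lia.
- by apply: path_sorted hv.
- by apply: sub_all hr => x; lia.
Qed.

(** The weight [G] depends on the u_j alone, so it factors out and [code_gf_sym] applies to each
    list. [ld] is abstract so that [ldes] of a signed permutation fits. *)
Lemma av321_sym (q t : R) (ld : 'S_n -> nat) (G : (nat -> bool) -> R) :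
  (0 < n)%N ->
  (forall p m, inc_from p m = (ld p <= m)%N) ->
  (forall D D', D =1 D' -> G D = G D') ->
  \sum_(p | av321 p) G (inv_des p) * q ^+ perm_bl p * t ^+ (n - ld p) =
  \sum_(p | av321 p) G (inv_des p) * q ^+ (n - ld p) * t ^+ perm_bl p.
Proof.
move=> hn hld hG.
have expand (x y : R) : \sum_(p | av321 p) G (inv_des p) * (x ^+ perm_bl p * y ^+ (n - ld p)) =
    sum_sub n (fun us => G (fun i => (i.+1 \in us) && (i \notin us)) * code_gf n x y 0 0 us).
  rewrite (@sum_av321 _ _ _ (fun us vs => G (fun i => (i.+1 \in us) && (i \notin us)) *
    (x ^+ gaps n 0 us vs * y ^+ (n - last 0%N vs)))).
    by apply: eq_sum_sub => us _ _; rewrite sum_posZ code_gf_sum_pos.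
  move=> p us vs hc; rewrite (perm_bl_code hn hc) (hG _ _ (code_inv_des hc)).
  have -> // : ld p = last 0%N vs.
  apply/eqP; rewrite eqn_leq -hld (code_inc hc) leqnn /=.
  by rewrite -(code_inc hc) hld leqnn.
transitivity (sum_sub n (fun us => G (fun i => (i.+1 \in us) && (i \notin us)) * code_gf n q t 0 0 us)).
  by rewrite -expand; apply: eq_bigr => p _; rewrite mulrA.
transitivity (sum_sub n (fun us => G (fun i => (i.+1 \in us) && (i \notin us)) * code_gf n t q 0 0 us)).
  apply: eq_sum_sub => us hs ha; rewrite code_gf_sym //.
  - have : sorted leq us by apply: sub_sorted hs => x y /ltnW.
    by case: (us) => //= u s ->.
  - by apply: sub_all ha => u /ltnW.
by rewrite -expand; apply: eq_bigr => p _; rewrite -mulrA [X in _ * X = _]mulrC.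
Qed.
End TypeA.

(** * Reduced words of signed permutations *)

Section SignedWords.
Variable n : nat.
Implicit Types (v w : spn n) (k l x y : 'I_n) (s : seq 'I_n) (a : 'I_n -> int).
Local Open Scope ring_scope.

Lemma spval_neq0 v i : spval v i != 0.
Proof. by rewrite /spval; case: (v.2 i); lia. Qed.

Lemma spval_abs v i j : `|spval v i|%N = `|spval v j|%N -> i = j.
Proof.
move=> h; apply: (@perm_inj _ v.1); apply: ord_inj.
by move: h; rewrite /spval; case: (v.2 i); case: (v.2 j); lia.
Qed.

Lemma spval_inj v w : spval v =1 spval w -> v = w.
Proof.
case: v w => [p e] [p' e'] E; congr (_, _).
  apply/permP => i; apply: val_inj; move: (E i); rewrite /spval /=.
  by case: (e i); case: (e' i); lia.
by apply/ffunP => i; move: (E i); rewrite /spval /=; case: (e i); case: (e' i) => //; lia.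
Qed.

(** An action on the positions of the window. On v = w^-1 it corresponds to prepending a letter to a
    word of [w]. *)
Definition act v k := spcomp v (gen k).

Definition swap k := tperm (ordpred k) k.

Lemma swapE k i : swap k i = (if i == k.-1 :> nat then k : nat else if i == k :> nat then k.-1 else i) :> nat.
Proof.
rewrite /swap; case: tpermP => [->|->|/eqP h1 /eqP h2] /=.
- by rewrite eqxx.
- by rewrite eqxx; case: eqP => // ->.
by move: h1 h2; rewrite -!(inj_eq val_inj) /= => /negbTE -> /negbTE ->.
Qed.

Lemma gen_perm k : (gen k).1 = if k == 0%N :> nat then 1%g else swap k.
Proof. by rewrite /gen; case: ifP. Qed.

Lemma gen_sign k i : (gen k).2 i = (k == 0%N :> nat) && (i == 0%N :> nat).
Proof. by rewrite /gen; case: ifP => _; rewrite ffunE. Qed.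

Lemma actE v k i : spval (act v k) i =
  if k == 0%N :> nat then (if i == 0%N :> nat then - spval v i else spval v i)
  else spval v (swap k i).
Proof.
have -> : spval (act v k) i = (if (gen k).2 i then - spval v ((gen k).1 i) else spval v ((gen k).1 i)).
  by rewrite /spval /act ffunE permM; case: ((gen k).2 i); case: (v.2 _); rewrite /= ?mulN1r ?mul1r ?opprK.
by rewrite gen_perm gen_sign; case: (k == 0%N :> nat); rewrite ?perm1.
Qed.

Lemma swapK k : involutive (swap k).
Proof. exact: tpermK. Qed.

Lemma actK v k : act (act v k) k = v.
Proof.
apply: spval_inj => i; rewrite !actE; case: eqP => hk; last by rewrite swapK.
by case: eqP => // _; rewrite opprK.
Qed.

Lemma spinvK : involutive (@spinv n).
Proof.
case=> p e; rewrite /spinv /= invgK; congr (_, _).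
by apply/ffunP => i; rewrite !ffunE permK.
Qed.

Lemma spinv_comp_gen w k : spinv (spcomp (gen k) w) = act (spinv w) k.
Proof.
rewrite /act /spinv /spcomp /=.
have hV : ((gen k).1^-1 = (gen k).1)%g by rewrite /gen; case: ifP => _ /=; rewrite ?invg1 ?tpermV.
congr (_, _); first by rewrite invMg hV.
apply/ffunP => i; rewrite !ffunE invMg hV permM permKV addbC; congr (_ (+) _).
by rewrite /gen; case: ifP => _ /=; rewrite ?perm1 ?ffunE.
Qed.

Definition invprod s := spinv (wordprod s).

Lemma invprod_cons k s : invprod (k :: s) = act (invprod s) k.
Proof. exact: spinv_comp_gen. Qed.

Lemma invprod_nil : invprod [::] = sp1 n.
Proof.
rewrite /invprod /= /spinv /sp1 /= invg1; congr (_, _).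
by apply/ffunP => i; rewrite !ffunE.
Qed.

Definition desc v k : bool :=
  if k == 0%N :> nat then spval v k < 0 else spval v k < spval v (ordpred k).

(** The Coxeter length in type B: negative entries, inversions and pairs with negative sum. *)
Definition len v : nat := (\sum_i (spval v i < 0)%R +
  \sum_(ij : 'I_n * 'I_n | (ij.1 < ij.2)%N)
    ((spval v ij.2 < spval v ij.1)%R + (spval v ij.1 + spval v ij.2 < 0)%R))%N.

Lemma ordpred_lt k : k != 0%N :> nat -> (ordpred k < k)%N.
Proof. by rewrite /= ltn_predL lt0n. Qed.

(** For k = 0 the sign change exchanges the two conditions on each pair containing the first
    position, and one negative entry is lost. Otherwise only the inversion at the swapped positions
    disappears. *)
Lemma len_act v k : desc v k -> len v = (len (act v k)).+1.
Proof.
rewrite /desc /len; case: ifP => hk hd.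
  rewrite -addSn; congr (_ + _)%N.
    rewrite [in LHS](bigD1 k) //= [in RHS](bigD1 k) //= actE hk hd.
    rewrite (_ : (- spval v k < 0) = false); last by lia.
    rewrite add1n add0n; congr _.+1; apply: eq_bigr => i hik; rewrite actE hk.
    by rewrite (_ : (i == 0%N :> nat) = false) // -(eqP hk); apply/negbTE.
  apply: eq_bigr => -[i j] /= hij; rewrite !actE hk.
  rewrite (_ : (j == 0%N :> nat) = false); last by lia.
  by case: eqP => // _; lia.
have hk' := negbT hk; have hlt := ordpred_lt hk'.
rewrite -addnS; congr (_ + _)%N.
  rewrite (reindex_inj (@perm_inj _ (swap k))) /=.
  by apply: eq_bigr => i _; rewrite actE hk.
rewrite (bigD1 (ordpred k, k)) //= hd.
(* [sw] keeps the order of every pair i < j other than (k - 1, k), so the sums agree once that pair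
   is split off. *)
pose sw (x : 'I_n * 'I_n) := (swap k x.1, swap k x.2).
rewrite [in RHS](reindex_onto sw sw) /=; last by case=> i j _; rewrite /sw /= !swapK.
rewrite [in RHS](bigD1 (k, ordpred k)) /=; last first.
  by rewrite /sw /= !swapK eqxx andbT !swapE /= !eqxx; case: eqP => //; lia.
rewrite !actE hk !swapK.
rewrite (_ : (spval v (ordpred k) < spval v k) = false); last by lia.
rewrite add1n addSn [spval v k + _]addrC add0n; congr (_ + _).+1.
apply: eq_big => [[i j]|[i j] _] /=; last by rewrite !actE hk !swapK.
rewrite /sw /= !swapK eqxx andbT !xpair_eqE -!(inj_eq val_inj) /= !swapE.
by repeat case: eqP => ? /=; lia.
Qed.
End SignedWords.

(** * Full commutativity as pattern avoidance *)

Lemma exists_descent n (f : 'I_n -> int) (i j : 'I_n) : i < j -> (f j < f i)%R ->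
  exists k : 'I_n, [/\ i < k, k <= j & (f k < f (ordpred k))%R].
Proof.
have [m] := ubnP j; elim: m j => // m IH j hm hij hf.
case: (ltP (f j) (f (ordpred j))) => [h|h]; first by exists j.
have hi : i != ordpred j by apply: contraTneq hf => ->; rewrite -leNgt.
have hij' : i < ordpred j.
  by move: hi; rewrite -(inj_eq val_inj) /=; lia.
have hj : ordpred j < m by rewrite /=; lia.
case: (IH _ hj hij' (le_lt_trans h hf)) => k [h1 h2 h3].
by exists k; split=> //; move: h2 => /=; lia.
Qed.

Section Bad.
Variable n : nat.
Implicit Types (v w : spn n) (i j k l : 'I_n).
Local Open Scope ring_scope.

Lemma exists_desc v i j : (i < j)%N -> spval v j < spval v i ->
  exists k : 'I_n, [/\ (i < k)%N, (k <= j)%N & desc v k].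
Proof.
move=> hij hv; have [k [h1 h2 h3]] := exists_descent hij hv.
by exists k; split=> //; rewrite /desc ifN //; lia.
Qed.

Lemma exists_desc0 v i : spval v i < 0 -> exists2 k : 'I_n, (k <= i)%N & desc v k.
Proof.
move=> hi; have h0 : (0 < n)%N by have := ltn_ord i; lia.
pose o := Ordinal h0.
case: (ltP (spval v o) 0) => ho; first by exists o.
have oi : (o < i)%N.
  rewrite lt0n; apply/negP => /eqP E; have E' : i = o by apply: ord_inj.
  by move: hi; rewrite E' ltNge ho.
by have [k [_ h2 h3]] := exists_desc oi (lt_le_trans hi ho); exists k.
Qed.

Definition has321 v := exists i j l : 'I_n, [/\ (i < j)%N, (j < l)%N,
  spval v l < spval v j & spval v j < spval v i].

(* Together with [has321] this covers every decreasing triple of the window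
   v_{-n} ... v_n whose positions have distinct absolute values, and the pattern
   [-1,-2]. *)
Definition has_signed_pattern v := exists j l : 'I_n, [/\ (j < l)%N, spval v l < spval v j &
  spval v j < 0 \/ exists2 i, i != l & spval v i + spval v j < 0].

Definition bad v := has321 v \/ has_signed_pattern v.

Lemma swap_lt k i j : (i < j)%N -> ~~ ((i == ordpred k) && (j == k)) -> (swap k i < swap k j)%N.
Proof.
rewrite -!(inj_eq val_inj) /= !swapE.
by repeat case: eqP => ? /=; lia.
Qed.

Lemma act_swap v k i : k != 0%N :> nat -> spval (act v k) (swap k i) = spval v i.
Proof. by move=> /negbTE hk; rewrite actE hk swapK. Qed.

Lemma act0_other v k i : k = 0%N :> nat -> i != k -> spval (act v k) i = spval v i.
Proof. by move=> hk; rewrite actE hk /= -(inj_eq val_inj) /= hk => /negbTE ->. Qed.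

Lemma act0_same v k : k = 0%N :> nat -> spval (act v k) k = - spval v k.
Proof. by move=> hk; rewrite actE hk. Qed.

Lemma swap_has321 v k i j l : k != 0%N :> nat -> (i < j)%N -> (j < l)%N ->
  spval v l < spval v j -> spval v j < spval v i ->
  ~~ ((i == ordpred k) && (j == k)) -> ~~ ((j == ordpred k) && (l == k)) -> bad (act v k).
Proof.
move=> hk hij hjl h1 h2 h3 h4; left; exists (swap k i), (swap k j), (swap k l).
by rewrite !act_swap // !swap_lt.
Qed.

Lemma swap_signed v k j l : k != 0%N :> nat -> (j < l)%N -> spval v l < spval v j ->
  (spval v j < 0 \/ exists2 i, i != l & spval v i + spval v j < 0) ->
  ~~ ((j == ordpred k) && (l == k)) -> bad (act v k).
Proof.
move=> hk hjl h1 h2 h3; right; exists (swap k j), (swap k l).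
rewrite !act_swap // swap_lt //; split=> //.
case: h2 => [|[i hi h]]; [by left | right; exists (swap k i)]; rewrite ?act_swap //.
by rewrite (inj_eq perm_inj).
Qed.

Lemma neg0_signed v k j l : k = 0%N :> nat -> (k < j)%N -> (j < l)%N -> spval v l < spval v j ->
  (spval v j < 0 \/ exists i, [/\ i != l, i != k & spval v i + spval v j < 0]) -> bad (act v k).
Proof.
move=> hk hkj hjl h1 h2; right; exists j, l.
have hj : j != k by rewrite -(inj_eq val_inj) /=; lia.
have hl : l != k by rewrite -(inj_eq val_inj) /=; lia.
rewrite !act0_other //; split=> //; case: h2 => [|[i [hil hik h]]]; [by left | right].
by exists i; rewrite ?act0_other.
Qed.

Lemma ltn_neq i j : (i < j)%N -> i != j.
Proof. by rewrite -(inj_eq val_inj) /=; lia. Qed.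

(** For k != 0 no decreasing pair sits at the ascent. For k = 0 the positive first entry turns
    negative, and a pattern using it yields a signed pattern. *)
Lemma bad_act_asc v k : ~~ desc v k -> bad v -> bad (act v k).
Proof.
rewrite /desc; case: ifP => [/eqP hk|/negbT hk]; rewrite -leNgt => hasc; last first.
  have nadj i j : spval v j < spval v i -> ~~ ((i == ordpred k) && (j == k)).
    by move=> h; apply/negP => /andP[/eqP E1 /eqP E2]; move: h; rewrite E1 E2 ltNge hasc.
  case=> [[i [j [l [h1 h2 h3 h4]]]]|[j [l [h1 h2 h3]]]].
    by apply: (swap_has321 hk h1 h2) => //; apply: nadj.
  by apply: (swap_signed hk h1 h2) => //; apply: nadj.
case=> [[i [j [l [h1 h2 h3 h4]]]]|[j [l [h1 h2 h3]]]].
  have [ik|hik] := eqVneq i k.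
    subst i; right; exists j, l.
    have hj : j != k by rewrite eq_sym ltn_neq.
    have hl : l != k by rewrite eq_sym ltn_neq //; lia.
    rewrite !act0_other //; split=> //; right; exists k; first by rewrite eq_sym.
    by rewrite act0_same //; lia.
  have hi : (k < i)%N by move: hik; rewrite -(inj_eq val_inj) /=; lia.
  left; exists i, j, l; rewrite !act0_other //.
  - by rewrite eq_sym ltn_neq //; lia.
  - by rewrite eq_sym ltn_neq //; lia.
have [jk|hjk] := eqVneq j k.
  subst j; case: h3 => [|[i hil hs]]; first by lia.
  have hik : i != k by apply/eqP => E; move: hs; rewrite E; lia.
  right; exists k, i; rewrite act0_same // act0_other //; split.
  - by move: hik; rewrite -(inj_eq val_inj) /=; lia.
  - by lia.
  - by left; have := spval_neq0 v k; lia.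
have hj : (k < j)%N by move: hjk; rewrite -(inj_eq val_inj) /=; lia.
apply: (neg0_signed hk hj h1 h2); case: h3 => [|[i hil hs]]; first by left.
have [ik|hik] := eqVneq i k; last by right; exists i.
by left; move: hs; rewrite ik; lia.
Qed.

Definition good_descent v := exists2 k, desc v k & bad (act v k).

(** A descent between two entries of the pattern can be used unless it exchanges exactly these two;
    on three consecutive positions the two descents are adjacent. *)
Lemma has321_desc v : has321 v -> good_descent v \/
  exists k l : 'I_n, [/\ l = k.+1 :> nat, desc v k & desc v l].
Proof.
case=> i [j [l [h1 h2 h3 h4]]].
have [d [hd1 hd2 hd]] := exists_desc h1 h4; have [e [he1 he2 he]] := exists_desc h2 h3.
have [hj|hj] := eqVneq (j : nat) i.+1; last first.
  left; exists d => //; apply: (swap_has321 _ h1 h2 h3 h4); rewrite -?(inj_eq val_inj) /=; lia.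
have [hl|hl] := eqVneq (l : nat) j.+1; last first.
  left; exists e => //; apply: (swap_has321 _ h1 h2 h3 h4); rewrite -?(inj_eq val_inj) /=; lia.
by right; exists d, e; split=> //; lia.
Qed.

Lemma neg_pair_desc v j l : (j < l)%N -> spval v l < spval v j -> spval v j < 0 ->
  good_descent v \/ exists k l : 'I_n, [/\ l = k.+1 :> nat, desc v k & desc v l].
Proof.
move=> h1 h2 h3.
have [e [he1 he2 he]] := exists_desc h1 h2; have [d hd1 hd] := exists_desc0 h3.
have [hl|hl] := eqVneq (l : nat) j.+1; last first.
  left; exists e => //; apply: (swap_signed _ h1 h2); rewrite -?(inj_eq val_inj) /=; try lia.
have [hj|hj] := eqVneq (j : nat) 0%N; first by right; exists d, e; split=> //; lia.
left; exists d => //; have [hd0|hd0] := eqVneq (d : nat) 0%N.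
  by apply: (neg0_signed hd0 _ h1 h2); [lia | left].
by apply: (swap_signed hd0 h1 h2); [left | rewrite -!(inj_eq val_inj) /=; lia].
Qed.

Lemma mixed_triple_desc v i j l : (j < l)%N -> spval v l < spval v j -> 0 < spval v j ->
  i != l -> spval v i + spval v j < 0 -> good_descent v.
Proof.
move=> h1 h2 h3 hil hs.
have hi0 : spval v i < 0 by lia.
have hij : i != j by apply/eqP => E; move: hs; rewrite E; lia.
have [d hd1 hd] := exists_desc0 hi0.
have [d0|d0] := eqVneq (d : nat) 0%N.
  have [id|hid] := eqVneq i d.
    (* The sign change turns v_i into -v_i > v_j, which creates a 321 pattern. *)
    subst d; exists i => //; left; exists i, j, l.
    have hl : l != i by rewrite eq_sym.
    rewrite act0_same // !act0_other //; last by rewrite eq_sym.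
    by split=> //; [move: hij; rewrite -(inj_eq val_inj) /=; lia | lia].
  have hdj : (d < j)%N.
    rewrite d0 lt0n; apply/eqP => hj; have E : j = d by apply: ord_inj; lia.
    by move: hd h3; rewrite /desc d0 /= E; lia.
  by exists d => //; apply: (neg0_signed d0 hdj h1 h2); right; exists i.
have [|hadj] := boolP ((j == ordpred d) && (l == d)); last first.
  by exists d => //; apply: (swap_signed d0 h1 h2) => //; right; exists i.
(* The descent exchanges the pair itself: j = d - 1 and l = d, hence i > d. *)
move=> /andP[/eqP Ej /eqP El]; subst l.
have hdi : (d < i)%N by move: hil; rewrite -(inj_eq val_inj) /=; lia.
case: (ltgtP (spval v d) (spval v i)) => hc; last first.
- by move: hil; rewrite (spval_abs (congr1 absz hc)) eqxx.
- have [e [he1 he2 he]] := exists_desc hdi hc; exists e => //.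
  apply: (swap_signed _ h1 h2); rewrite -?(inj_eq val_inj) /=; try lia.
  by right; exists i.
(* Now v_l < v_i < 0 < v_j. After the exchange v_j stands left of v_i, and v_l, moved to position
   [j], is the partner with v_l + v_j < 0. *)
exists d => //; right; exists d, i.
have sdj : swap d d = j by rewrite Ej /swap tpermR.
have sjd : swap d j = d by rewrite Ej /swap tpermL.
have sii : swap d i = i by rewrite /swap tpermD // -?Ej // eq_sym.
have actd : spval (act v d) d = spval v j by rewrite -{2}sjd act_swap.
have actj : spval (act v d) j = spval v d by rewrite -{1}sdj act_swap.
have acti : spval (act v d) i = spval v i by rewrite -{1}sii act_swap.
rewrite actd acti; split=> //; first by lia.
by right; exists j; rewrite ?actj; [rewrite eq_sym | lia].
Qed.

Lemma bad_desc v : bad v -> good_descent v \/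
  exists k l : 'I_n, [/\ l = k.+1 :> nat, desc v k & desc v l].
Proof.
case=> [|[j [l [h1 h2 h3]]]]; first exact: has321_desc.
case: (ltgtP (spval v j) 0) => hj.
- exact: neg_pair_desc h1 h2 hj.
- case: h3 => [|[i hil hs]]; first by lia.
  by left; apply: mixed_triple_desc h1 h2 hj hil hs.
- by have := spval_neq0 v j; rewrite hj.
Qed.

Lemma adjacent_desc_bad v k l : l = k.+1 :> nat -> desc v k -> desc v l -> bad v.
Proof.
rewrite /desc => hkl; rewrite hkl /=.
have E : ordpred l = k by apply: ord_inj; rewrite /= hkl.
rewrite E; case: ifP => [/eqP k0|/negbT k0] hk hl.
  by right; exists k, l; split=> //; [lia | left].
by left; exists (ordpred k), k, l; split=> //=; lia.
Qed.
End Bad.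

(** * Reduced words of elements without bad patterns *)

Section FullyCommutative.
Variable n : nat.
Implicit Types (v w : spn n) (i j k l x y : 'I_n) (s : seq 'I_n).

Lemma desc_act v k : desc (act v k) k = ~~ desc v k.
Proof.
rewrite /desc; case: ifP => [/eqP hk|/negbT hk].
  by rewrite act0_same //; have := spval_neq0 v k; lia.
have E1 : spval (act v k) k = spval v (ordpred k).
  by rewrite -[in RHS](act_swap v (ordpred k) hk) /swap tpermL.
have E2 : spval (act v k) (ordpred k) = spval v k.
  by rewrite -[in RHS](act_swap v k hk) /swap tpermR.
rewrite E1 E2 -leNgt le_eqVlt orbC; case: ltP => //= _; apply/esym/negP => /eqP E.
by have := congr1 val (spval_abs (congr1 absz E)); have := ordpred_lt hk; rewrite /=; lia.
Qed.

Lemma len_act_asc v k : ~~ desc v k -> len (act v k) = (len v).+1.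
Proof. by rewrite -desc_act => /len_act; rewrite actK. Qed.

Lemma act_sp1 k : act (sp1 n) k = gen k.
Proof.
rewrite /act /spcomp mulg1; case: (gen k) => p e /=; congr (_, _).
by apply/ffunP => i; rewrite !ffunE addbF.
Qed.

Lemma swap_cases k i : (i = k.-1 :> nat /\ swap k i = k :> nat) \/
  (i = k :> nat /\ swap k i = k.-1 :> nat) \/
  (i <> k.-1 :> nat /\ i <> k :> nat /\ swap k i = i :> nat).
Proof. by rewrite swapE; case: eqP => ?; [|case: eqP => ?]; lia. Qed.

Lemma act_comm v x y : x.+1 < y -> act (act v x) y = act (act v y) x.
Proof.
move=> hxy; apply: spval_inj => i; rewrite !actE.
have hy : (y == 0 :> nat) = false by lia.
rewrite hy; case: eqP => [hx|hx].
  rewrite !swapE.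
  suff -> : ((if i == y.-1 :> nat then y : nat else if i == y :> nat then y.-1 else i) == 0)
    = (i == 0 :> nat) by [].
  by case: (eqVneq (i : nat) y.-1) => ?; case: (eqVneq (i : nat) y) => ?; lia.
congr (spval v _); apply: ord_inj.
have := swap_cases x i; have := swap_cases y i.
by have := swap_cases x (swap y i); have := swap_cases y (swap x i); lia.
Qed.

Lemma desc_act_apart v x y : x.+1 < y \/ y.+1 < x -> desc (act v x) y = desc v y.
Proof.
move=> hxy; rewrite /desc.
have E i : (i = y :> nat \/ i = y.-1 :> nat) -> spval (act v x) i = spval v i.
  move=> hi; rewrite actE; case: eqP => hx; first by case: eqP => //; lia.
  by congr (spval v _); apply: ord_inj; rewrite swapE; repeat case: eqP => ? /=; lia.
by rewrite !E //=; [right | left].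
Qed.

Lemma gen_comm x y : x.+1 < y -> spcomp (gen x) (gen y) = spcomp (gen y) (gen x).
Proof. by move=> hxy; have := act_comm (sp1 n) hxy; rewrite !act_sp1. Qed.

(** For x = 0 the products differ in the sign at [x], otherwise in the image of x - 1. *)
Lemma gen_noncomm x y : y = x.+1 :> nat -> spcomp (gen x) (gen y) <> spcomp (gen y) (gen x).
Proof.
move=> hxy; case: (posnP x) => [x0|xpos].
  have h (w w' : spn n) : (spcomp w w').2 x = w'.2 x (+) w.2 (w'.1 x) by rewrite ffunE.
  have hs : swap y x = 1 :> nat by have := swap_cases y x; lia.
  have hx : (x == 0 :> nat) = true by rewrite x0.
  have hy : (y == 0 :> nat) = false by lia.
  by move=> /(congr1 (fun w : spn n => w.2 x)); rewrite !h !gen_sign !gen_perm hx hy hs.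
have hx : (x == 0 :> nat) = false by lia.
have hy : (y == 0 :> nat) = false by lia.
move=> /(congr1 (fun w : spn n => w.1 (ordpred x))).
rewrite /spcomp !permM !gen_perm hx hy => E.
have E' : swap x (swap y (ordpred x)) = swap y (swap x (ordpred x)) :> nat by rewrite E.
have : ordpred x = x.-1 :> nat by [].
move: (ordpred x) E' => p E' hp; have := swap_cases x p; have := swap_cases y p.
by have := swap_cases x (swap y p); have := swap_cases y (swap x p); lia.
Qed.

Lemma act_braid3 v x y : x != 0 :> nat -> y = x.+1 :> nat ->
  act (act (act v x) y) x = act (act (act v y) x) y.
Proof.
move=> hx hxy; apply: spval_inj => i; rewrite !actE.
have -> : (x == 0 :> nat) = false by lia.
have -> : (y == 0 :> nat) = false by lia.
congr (spval v _); apply: ord_inj.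
suff h a b : (a = x /\ b = y) \/ (a = y /\ b = x) -> swap a (swap b (swap a i)) =
    (if i == x.-1 :> nat then y : nat else if i == y :> nat then x.-1 else i) :> nat.
  by rewrite !h; [|right|left].
move=> hab; case: (eqVneq (i : nat) x.-1) => hi1; case: (eqVneq (i : nat) y) => hi2;
have := swap_cases a i; have := swap_cases b (swap a i);
by have := swap_cases a (swap b (swap a i)); case: hab => [[-> ->]|[-> ->]]; lia.
Qed.

Lemma act_braid4 v x y : x = 0 :> nat -> y = x.+1 :> nat ->
  act (act (act (act v x) y) x) y = act (act (act (act v y) x) y) x.
Proof.
move=> hx hxy; apply: spval_inj => i.
have hpy : ordpred y = x by apply: ord_inj; rewrite /= hxy.
have hy0 : y != 0 :> nat by lia.
have sx : swap y x = y by rewrite /swap hpy tpermL.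
have sy : swap y y = x by rewrite /swap hpy tpermR.
have hyx : y != x by rewrite -(inj_eq val_inj) /=; lia.
have ax w : spval (act w y) x = spval w y by rewrite -{1}sy act_swap.
have ay w : spval (act w y) y = spval w x by rewrite -{2}sx act_swap.
have bx w : (spval (act w x) x = - spval w x)%R by exact: act0_same.
have fix_x w j : j != x -> spval (act w x) j = spval w j by exact: act0_other.
have [->|ix] := eqVneq i x; first by rewrite !(ax, ay, bx, fix_x _ _ hyx).
have [->|iy] := eqVneq i y; first by rewrite !(ax, ay, bx, fix_x _ _ hyx).
have si : swap y i = i by rewrite /swap tpermD // ?hpy eq_sym.
have ai w : spval (act w y) i = spval w i by rewrite -{1}si act_swap.
by rewrite !(ai, fix_x _ _ ix).
Qed.

Lemma len_invprod s : len (invprod s) <= size s.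
Proof.
elim: s => [|k s IH] /=.
  rewrite invprod_nil /len !big1 // => [[i j]|i _] /=; rewrite /spval /= !ffunE; last lia.
  by rewrite !perm1 => hij; lia.
rewrite invprod_cons; case: (boolP (desc (invprod s) k)) => [/len_act|/len_act_asc]; lia.
Qed.

Lemma perm_increasing (p : 'S_n) : (forall i j, i < j -> p i < p j) -> p = 1%g.
Proof.
move=> hp.
have le_p (r : 'S_n) : (forall i j, i < j -> r i < r j) -> forall i, i <= r i.
  move=> hr i; have [m] := ubnP (i : nat); elim: m i => // m IH i hm.
  case: (posnP i) => [->//|hi].
  have hlt : ordpred i < i by rewrite /=; lia.
  have h1 : ordpred i < m by lia.
  by have := IH _ h1; have := hr _ _ hlt; rewrite /=; lia.
apply/permP => i; rewrite perm1; apply: ord_inj; apply/eqP; rewrite eqn_leq le_p // andbT.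
rewrite -{2}(permK p i); apply: le_p => a b hab; rewrite ltnNge leq_eqVlt; apply/negP => /orP[|h].
  by rewrite (inj_eq val_inj) (inj_eq perm_inj) => /eqP E; rewrite E ltnn in hab.
by have := hp _ _ h; rewrite !permKV; lia.
Qed.

Lemma no_desc_sp1 v : (forall k, ~~ desc v k) -> v = sp1 n.
Proof.
move=> hd.
have pos i : ((spval v i < 0) = false)%R.
  by apply/negP => /exists_desc0[k _]; apply/negP.
have sgn i : v.2 i = false.
  by have := pos i; rewrite /spval; case: (v.2 i) => //; lia.
case: v hd pos sgn => p e hd pos sgn; congr (_, _); last first.
  by apply/ffunP => i; rewrite ffunE; apply: sgn.
apply: perm_increasing => i j hij; rewrite ltnNge leq_eqVlt; apply/negP => /orP[|h].
  by rewrite (inj_eq val_inj) (inj_eq perm_inj) => /eqP E; rewrite E ltnn in hij.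
have hv : (spval (p, e) j < spval (p, e) i)%R.
  by rewrite /spval !sgn !mul1r ltz_nat ltnS.
by have [k [_ _]] := exists_desc hij hv; apply/negP.
Qed.

Lemma exists_word v : exists2 s, invprod s = v & size s = len v.
Proof.
have [m] := ubnP (len v); elim: m v => // m IH v hm.
case: (pickP (desc v)) => [k hk|hd].
  have hl := len_act hk; case: (IH (act v k)) => [|s hs hsz]; first by lia.
  by exists (k :: s); rewrite ?invprod_cons ?hs ?actK //= hsz hl.
exists [::]; first by rewrite invprod_nil; symmetry; apply: no_desc_sp1 => k; rewrite hd.
have -> : v = invprod [::] by rewrite invprod_nil; apply: no_desc_sp1 => k; rewrite hd.
by have := len_invprod [::]; rewrite /=; lia.
Qed.

(** No word is shorter than [len], and [exists_word] attains it, so minimality becomes a numerical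
    condition. *)
Lemma reduced_wordP w s : reduced_word w s <-> invprod s = spinv w /\ size s = len (spinv w).
Proof.
have E s' : wordprod s' = w <-> invprod s' = spinv w.
  by rewrite /invprod; split=> [->//|/(can_inj (@spinvK n))].
split=> [[/E h1 h2]|[h1 h2]]; split=> //.
- have [s' hs' hsz] := exists_word (spinv w).
  by apply/eqP; rewrite eqn_leq -{2}h1 len_invprod andbT -hsz; apply/h2/E.
- exact/E.
- by move=> s' /E h; rewrite h2 -h len_invprod.
Qed.

Lemma comm_closure_cons k s1 s2 :
  clos_refl_trans _ (@comm_step n) s1 s2 -> clos_refl_trans _ (@comm_step n) (k :: s1) (k :: s2).
Proof.
elim=> [a b [c [d [x [y [h [-> ->]]]]]]|a|a b c _ h1 _ h2].
- by apply: rt_step; exists (k :: c), d, x, y.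
- exact: rt_refl.
- exact: rt_trans h1 h2.
Qed.

Lemma reduced_tail v k s : invprod (k :: s) = v -> size (k :: s) = len v ->
  [/\ desc v k, invprod s = act v k & size s = len (act v k)].
Proof.
rewrite invprod_cons => <- /= hs; rewrite actK desc_act.
have := len_invprod s; case: (boolP (desc (invprod s) k)) => [/len_act|/len_act_asc] h1 h2; first lia.
by split=> //; lia.
Qed.

(** Both first letters are descents. If distinct, they are not adjacent by [adjacent_desc_bad], so
    they commute, and words beginning with both link the given ones by induction on length. *)
Lemma good_comm_closure v s1 s2 : ~ bad v ->
  invprod s1 = v -> size s1 = len v -> invprod s2 = v -> size s2 = len v ->
  clos_refl_trans _ (@comm_step n) s1 s2.
Proof.
have [m] := ubnP (len v); elim: m v s1 s2 => // m IH v [|x a] [|y b] hm hgood h1 h1' h2 h2'.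
- exact: rt_refl.
- by rewrite -h1' in h2'.
- by rewrite -h2' in h1'.
have [dx ha ha'] := reduced_tail h1 h1'; have [dy hb hb'] := reduced_tail h2 h2'.
have good_act w k : ~ bad w -> desc w k -> ~ bad (act w k).
  by move=> hw hk hb0; apply: hw; rewrite -(actK w k); apply: bad_act_asc; rewrite // desc_act hk.
have hlx := len_act dx; have hly := len_act dy.
have gx := good_act _ _ hgood dx; have gy := good_act _ _ hgood dy.
have [exy|nxy] := eqVneq x y.
  subst y; apply: comm_closure_cons; apply: (IH (act v x)) => //; lia.
have apart : x.+1 < y \/ y.+1 < x.
  have hxy : (x : nat) <> y by move=> E; move: nxy; rewrite (ord_inj E) eqxx.
  have h3 : (y : nat) <> x.+1 by move=> E; apply: hgood; apply: adjacent_desc_bad E dx dy.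
  have h4 : (x : nat) <> y.+1 by move=> E; apply: hgood; apply: adjacent_desc_bad E dy dx.
  by lia.
have hcomm w : act (act w x) y = act (act w y) x.
  by case: apart => h; [|symmetry]; apply: act_comm.
have hgen : spcomp (gen x) (gen y) = spcomp (gen y) (gen x).
  by case: apart => h; [|symmetry]; apply: gen_comm.
have dxy : desc (act v x) y.
  by rewrite desc_act_apart.
have [c hc hc'] := exists_word (act (act v x) y).
have hlxy := len_act dxy.
apply: (rt_trans _ _ _ (x :: y :: c)).
  apply: comm_closure_cons; apply: (IH (act v x)) => //=; [lia| |lia].
  by rewrite invprod_cons hc actK.
apply: (rt_trans _ _ _ (y :: x :: c)).
  by apply: rt_step; exists [::], c, x, y.
apply: comm_closure_cons; apply: (IH (act v y)) => //=; [lia| |lia].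
by rewrite invprod_cons hc hcomm actK.
Qed.
End FullyCommutative.

(** * Reduced words not related by commutations *)

Section Converse.
Variable n : nat.
Implicit Types (v w : spn n) (i j k l x y : 'I_n) (s : seq 'I_n).

Lemma comm_closure_filter x y s1 s2 : y = x.+1 :> nat ->
  clos_refl_trans _ (@comm_step n) s1 s2 -> filter (pred2 x y) s1 = filter (pred2 x y) s2.
Proof.
move=> hxy; elim=> [a b [c [d [x' [y' [h [-> ->]]]]]]|a|a b c _ h1 _ h2] //; last by rewrite h1.
have hxy' : pred2 x y x' -> pred2 x y y' -> x' = y'.
  move=> /pred2P[ex|ex] /pred2P[ey|ey]; rewrite ex ey //.
    by case: (gen_noncomm hxy); rewrite -ex -ey.
  by case: (gen_noncomm hxy); rewrite -ex -ey.
rewrite !filter_cat -![filter _ (_ :: _)]/(if _ then _ else _); congr (_ ++ _).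
by move: hxy'; case: (pred2 x y x'); case: (pred2 x y y') => // ->.
Qed.

(* The subword on two fixed non-commuting letters is invariant under commutations,
   and unlike commutation inequivalence, its disagreement survives prefixing. *)
Definition braided v := exists s1 s2 x y,
  [/\ invprod s1 = v, size s1 = len v, invprod s2 = v, size s2 = len v &
      y = x.+1 :> nat /\ filter (pred2 x y) s1 <> filter (pred2 x y) s2].

(** The letters [x], [y], [x] (and [y] again when x = 0) are successive descents, so some reduced
    word starts with them. After the braid relation the filtered words differ in their first
    letter. *)
Lemma adjacent_desc_braided v x y : y = x.+1 :> nat -> desc v x -> desc v y -> braided v.
Proof.
move=> hxy dx dy.
have hyx : y != x by rewrite -(inj_eq val_inj) /=; lia.
have hy0 : y != 0 :> nat by lia.
have hpy : ordpred y = x by apply: ord_inj; rewrite /= hxy.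
have ax w : spval (act w y) x = spval w y.
  by rewrite -[in RHS](act_swap w y hy0) /swap tpermR hpy.
have ay w : spval (act w y) y = spval w x.
  by rewrite -[in RHS](act_swap w x hy0) /swap hpy tpermL.
have descy w : desc w y = (spval w y < spval w x)%R by rewrite /desc hpy; case: eqP hy0.
have lx := len_act dx.
have [hx|hx] := eqVneq (x : nat) 0.
  have bx w : (spval (act w x) x = - spval w x)%R by exact: act0_same.
  have fix_y w : spval (act w x) y = spval w y by exact: act0_other.
  have descx w : desc w x = (spval w x < 0)%R by rewrite /desc hx.
  rewrite descx in dx; rewrite descy in dy.
  have d2 : desc (act v x) y by rewrite descy bx fix_y; lia.
  have d3 : desc (act (act v x) y) x by rewrite descx ax fix_y; lia.
  have d4 : desc (act (act (act v x) y) x) y by rewrite descy !(bx, fix_y, ax, ay); lia.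
  have l2 := len_act d2; have l3 := len_act d3; have l4 := len_act d4.
  have [c hc hc'] := exists_word (act (act (act (act v x) y) x) y).
  exists (x :: y :: x :: y :: c), (y :: x :: y :: x :: c), x, y.
  have hsz : (size c).+4 = len v by lia.
  rewrite !invprod_cons hc !actK act_braid4 // !actK /= hsz; split=> //.
  by split=> //; rewrite !eqxx orbT => -[E]; rewrite E eqxx in hyx.
set p := ordpred x.
have xp : x != p by rewrite -(inj_eq val_inj) /=; lia.
have yp : y != p by rewrite -(inj_eq val_inj) /=; lia.
have bp w : spval (act w x) p = spval w x.
  by rewrite -[in RHS](act_swap w x hx) /swap tpermR.
have bx w : spval (act w x) x = spval w p.
  by rewrite -[in RHS](act_swap w p hx) /swap tpermL.
have fix_y w : spval (act w x) y = spval w y.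
  by rewrite -[in RHS](act_swap w y hx) /swap tpermD // eq_sym.
have ap w : spval (act w y) p = spval w p.
  by rewrite -[in RHS](act_swap w p hy0) /swap tpermD // hpy.
have descx w : desc w x = (spval w x < spval w p)%R by rewrite /desc; case: eqP hx.
rewrite descx in dx; rewrite descy in dy.
have d2 : desc (act v x) y by rewrite descy bx fix_y; lia.
have d3 : desc (act (act v x) y) x by rewrite descx ax fix_y ap bp; lia.
have l2 := len_act d2; have l3 := len_act d3.
have [c hc hc'] := exists_word (act (act (act v x) y) x).
exists (x :: y :: x :: c), (y :: x :: y :: c), x, y.
have hsz : (size c).+3 = len v by lia.
rewrite !invprod_cons hc !actK -act_braid3 // !actK /= hsz; split=> //.
by split=> //; rewrite !eqxx orbT => -[E]; rewrite E eqxx in hyx.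
Qed.

Lemma bad_braided v : bad v -> braided v.
Proof.
have [m] := ubnP (len v); elim: m v => // m IH v hm hb.
case: (bad_desc hb) => [[k hk hbk]|[x [y [hxy dx dy]]]]; last exact: adjacent_desc_braided hxy dx dy.
have hl := len_act hk.
case: (IH (act v k)) => [|//|s1 [s2 [x [y [h1 h2 h3 h4 [hxy hf]]]]]]; first by lia.
exists (k :: s1), (k :: s2), x, y; rewrite !invprod_cons h1 h3 !actK /= h2 h4 hl.
by split=> //; split=> //; case: ifP => // _ [].
Qed.

Lemma fully_commutativeP w : fully_commutative w <-> ~ bad (spinv w).
Proof.
split=> [hw hb|hb s1 s2 /reduced_wordP[h1 h1'] /reduced_wordP[h2 h2']]; last first.
  exact: good_comm_closure hb h1 h1' h2 h2'.
have [s1 [s2 [x [y [h1 h1' h2 h2' [hxy]]]]]] := bad_braided hb.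
by apply; apply: comm_closure_filter hxy _; apply: hw; apply/reduced_wordP.
Qed.
End Converse.

(** * Standardization *)

Section WordOrder.
Variable n : nat.
Implicit Types (v w : spn n) (p : 'S_n) (i j k : 'I_n).
Local Open Scope ring_scope.

Lemma wvE v i : wv v i.+1 = spval v i.
Proof. by rewrite /wv /= (nth_map i) ?size_enum_ord // nth_ord_enum. Qed.

Lemma bigmax_lt_nat (F : nat -> int) (x0 y : int) lo hi : x0 < y ->
  (forall j : nat, (lo <= j < hi)%N -> F j < y) -> \big[Num.max/x0]_(lo <= j < hi) F j < y.
Proof.
by move=> h0 h; rewrite big_nat; apply: (big_ind (fun u => u < y)) => // a b ha hb; rewrite gt_max ha hb.
Qed.

Lemma lt_bigmin_nat (F : nat -> int) (x0 y : int) lo hi : y < x0 ->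
  (forall j : nat, (lo <= j < hi)%N -> y < F j) -> y < \big[Num.min/x0]_(lo <= j < hi) F j.
Proof.
by move=> h0 h; rewrite big_nat; apply: (big_ind (fun u => y < u)) => // a b ha hb; rewrite lt_min ha hb.
Qed.

Lemma bl_perm_bl v p : (forall i j, (spval v i < spval v j) = (p i < p j)%N) ->
  bl v = perm_bl p.
Proof.
move=> hvp; rewrite /bl /perm_bl; congr (_ + _)%N; apply: eq_big_nat => m /andP[hm1 hmn].
congr nat_of_bool; apply/idP/perm_cutP => [h i j hi hj|h].
  rewrite -hvp -!wvE; apply: le_lt_trans (lt_le_trans h _).
    by apply: le_bigmax_seq => //; rewrite mem_index_iota; lia.
  by apply: bigmin_inf_seq (lexx _) => //; rewrite mem_index_iota; have := ltn_ord j; lia.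
have H (i j : nat) : (1 <= i < m.+1)%N -> (m.+1 <= j < n.+1)%N -> wv v i < wv v j.
  case: i j => [|i] [|j] //.
  move=> hi hj; have hi' : (i < n)%N by lia.
  have hj' : (j < n)%N by lia.
  rewrite -[i]/(nat_of_ord (Ordinal hi')) -[j]/(nat_of_ord (Ordinal hj')) !wvE hvp.
  by apply: h => /=; lia.
(* The default values [wv v 1] and [wv v n] belong to the two ranges, so [H] covers them as well. *)
apply: lt_bigmin_nat => [|j hj]; apply: bigmax_lt_nat => [|i hi]; apply: H; lia.
Qed.

Lemma DesB_ord v k : k != 0%N :> nat -> DesB v k = (spval v k < spval v (ordpred k)).
Proof.
move=> hk; rewrite /DesB ltn_ord -!wvE /= prednK //; lia.
Qed.

(** A descent at 0, the only one that depends on a sign, adds 0 to the maximum, so the relative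
    order of the entries determines [ldes]. *)
Lemma inc_from_ldes v p m : (forall i j, (spval v i < spval v j) = (p i < p j)%N) ->
  inc_from p m = (ldes v <= m)%N.
Proof.
move=> hvp; apply/inc_fromP/idP => [h|h i j hmi hij].
  apply/bigmax_leqP_seq => i; rewrite mem_index_iota => /andP[_ hi] hd.
  rewrite leqNgt; apply/negP => hmi.
  have i0 : Ordinal hi != 0%N :> nat by rewrite /=; lia.
  move: hd; rewrite (DesB_ord v i0) ltNge ltW // hvp.
  by apply: h; rewrite /=; lia.
rewrite -hvp ltNge le_eqVlt; apply/negP => /orP[/eqP E|hv].
  by have := spval_abs (congr1 absz E) => E'; rewrite E' ltnn in hij.
have [k [h1 h2 h3]] := exists_descent hij hv.
have hk0 : k != 0%N :> nat by lia.
have : (k <= ldes v)%N.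
  apply: (@leq_bigmax_seq _ _ (DesB v) id); first by rewrite mem_index_iota /=.
  by rewrite DesB_ord.
lia.
Qed.
End WordOrder.

(** * Signed permutations with a fixed sign vector *)

Section Signs.
Variable n : nat.
Variable e : {ffun 'I_n -> bool}.
Implicit Types (p : 'S_n) (i j k r : 'I_n).
Local Open Scope ring_scope.

(** The entries of the window of w^-1: the sign vector of [w] fixes which absolute values occur
    negatively, hence the set of entries. *)
Definition signed i : int := (if e i then -1 else 1) * (Posz i.+1).

Lemma signed_inj : injective signed.
Proof.
move=> i j h; apply: ord_inj; move: h; rewrite /signed; case: (e i); case: (e j); lia.
Qed.

Definition rank_fun i : 'I_n :=
  insubd i #|[set j | signed j < signed i]|.

Lemma rank_funE i : rank_fun i = #|[set j | signed j < signed i]| :> nat.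
Proof.
rewrite /rank_fun insubdK // unfold_in -[X in (_ < X)%N](card_ord n) -cardsT.
apply: proper_card; apply/properP; split; first exact: subsetT.
by exists i; rewrite ?inE ?ltxx.
Qed.

Lemma rank_fun_lt i j : signed i < signed j -> (rank_fun i < rank_fun j)%N.
Proof.
move=> hij; rewrite !rank_funE; apply: proper_card; apply/properP; split.
  by apply/subsetP => k; rewrite !inE => hk; apply: lt_trans hij.
by exists i; rewrite !inE ?ltxx.
Qed.

Lemma rank_fun_inj : injective rank_fun.
Proof.
move=> i j E; apply: signed_inj; apply/eqP; rewrite eq_le !leNgt.
by apply/andP; split; apply/negP => /rank_fun_lt; rewrite E ltnn.
Qed.

Definition rank : 'S_n := perm rank_fun_inj.

Lemma rank_lt i j : (rank i < rank j)%N = (signed i < signed j).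
Proof.
rewrite !permE; apply/idP/idP => [h|/rank_fun_lt//].
rewrite ltNge le_eqVlt; apply/negP => /orP[/eqP/signed_inj E|/rank_fun_lt h'].
  by rewrite E ltnn in h.
by have := ltn_trans h h'; rewrite ltnn.
Qed.

(** No integer lies in between. This is how neighbouring positions of [w] with equal signs become
    consecutive ranks, linking Des_B(w) to inverse descents. *)
Lemma rank_succ i j : signed j = signed i + 1 -> rank j = (rank i).+1 :> nat.
Proof.
move=> h; rewrite !permE !rank_funE.
have -> : [set k | signed k < signed j] = i |: [set k | signed k < signed i].
  apply/setP => k; rewrite !inE h -(inj_eq signed_inj); lia.
by rewrite cardsU1 !inE ltxx.
Qed.

Definition level r : int := signed ((rank^-1)%g r).

Lemma level_lt r r' : (level r < level r') = (r < r')%N.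
Proof. by rewrite /level -rank_lt !permKV. Qed.

Lemma level_le r r' : (level r <= level r') = (r <= r')%N.
Proof. by rewrite !leNgt level_lt -leqNgt. Qed.

(* The signed permutation with sign vector e whose inverse standardizes to p. *)
Definition of_std p : spn n := ((rank * p^-1)%g, e).

Lemma of_std_bij : bijective (fun p => (of_std p).1).
Proof.
exists (fun s : 'S_n => (s^-1 * rank)%g) => p /=; first by rewrite invMg invgK mulgKV.
by rewrite invMg invgK mulKVg.
Qed.

Lemma spval_inv_of_std p i : spval (spinv (of_std p)) i = level (p i).
Proof. by rewrite /spval /spinv /= ffunE invMg invgK permM. Qed.

Lemma lt_inv_of_std p i j :
  (spval (spinv (of_std p)) i < spval (spinv (of_std p)) j) = (p i < p j)%N.
Proof. by rewrite !spval_inv_of_std level_lt. Qed.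

(* When r < r', this says that the patterns of [has_signed_pattern] forbid the
   value of rank r' to appear to the left of the value of rank r. *)
Definition ordered r r' : bool :=
  (level r' < 0) || [exists k : 'I_n, (k != r) && (level k + level r' < 0)].

Definition forbidden (D : nat -> bool) : bool :=
  [exists r : 'I_n, exists r' : 'I_n, [&& r' == r.+1 :> nat, ordered r r' & D r]].

(* Hence all these constraints follow from those between consecutive ranks, which
   only involve inverse descents. *)
Lemma ordered_interval r r' k k' : ordered r r' -> (r <= k)%N -> (k < k')%N -> (k' <= r')%N ->
  ordered k k'.
Proof.
move=> /orP[h|/existsP[l /andP[hl h]]] h1 h2 h3; apply/orP.
  by left; move: h3; rewrite -level_le; lia.
right; have [E|hne] := eqVneq l k.
  subst l; apply/existsP; exists r; rewrite eq_sym hl /=.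
  have hrk : (r < k)%N by move: hl; rewrite -(inj_eq val_inj) /=; lia.
  by move: hrk h3; rewrite -level_lt -level_le; lia.
by apply/existsP; exists l; rewrite hne /=; move: h3; rewrite -level_le; lia.
Qed.

Lemma inv_des_perm p r r' : r' = r.+1 :> nat ->
  inv_des p r = ((p^-1)%g r' < (p^-1)%g r)%N.
Proof.
move=> h; apply/inv_desP/idP => [[a [b [hab ha hb]]]|hr].
  have -> : r' = p a by apply: ord_inj; rewrite ha h.
  have -> : r = p b by apply: ord_inj; rewrite hb.
  by rewrite !permK.
by exists ((p^-1)%g r'), ((p^-1)%g r); rewrite !permKV.
Qed.

Lemma bad_of_std p : bad (spinv (of_std p)) <-> ~~ (av321 p && ~~ forbidden (inv_des p)).
Proof.
have V := spval_inv_of_std p; rewrite negb_and negbK; split.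
  case=> [[i [j [l [h1 h2]]]]|[j [l [h1 h2 h3]]]].
    rewrite !lt_inv_of_std => h3 h4; apply/orP; left; apply/negP => /av321P h.
    exact: (h i j l).
  rewrite lt_inv_of_std in h2; apply/orP; right.
  have hord : ordered (p l) (p j).
    apply/orP; case: h3 => [h|[i hil h]]; [left | right]; first by rewrite -V.
    by apply/existsP; exists (p i); rewrite (inj_eq perm_inj) hil -!V.
  (* [exists_descent] is applied to inverse positions: between the ranks p l < p j two consecutive
     ranks occur in reverse order, and [ordered_interval] passes the constraint to them. *)
  have hpos : (Posz ((p^-1)%g (p j)) < Posz ((p^-1)%g (p l)))%R by rewrite !permK ltz_nat.
  have [k [hk1 hk2]] := @exists_descent _ (fun r => Posz ((p^-1)%g r)) _ _ h2 hpos.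
  rewrite ltz_nat => hk3.
  have hk : k = (ordpred k).+1 :> nat by rewrite /= prednK //; lia.
  apply/existsP; exists (ordpred k); apply/existsP; exists k.
  rewrite -hk eqxx (inv_des_perm p hk) hk3 andbT /=.
  by apply: (ordered_interval hord) => //; lia.
case/orP => [/forallPn[i /forallPn[j /forallPn[l]]]|].
  rewrite negbK => /and4P[h1 h2 h3 h4]; left; exists i, j, l.
  by rewrite !lt_inv_of_std.
case/existsP => r /existsP[r' /and3P[/eqP h hord]]; rewrite (inv_des_perm p h) => hr.
right; exists ((p^-1)%g r'), ((p^-1)%g r).
rewrite lt_inv_of_std !V !permKV; split=> //; first by rewrite h.
case/orP: hord => [|/existsP[k /andP[hk1 hk2]]]; [by left | right].
exists ((p^-1)%g k); first by rewrite (inj_eq perm_inj).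
by rewrite V permKV.
Qed.

(** Des_B(w) read off from signs and inverse descents. The clause [~~ e (ordpred k)] also discards
    two negative neighbours, whose descent would be forbidden. *)
Definition descents (D : nat -> bool) (m : nat) : bool :=
  [exists k : 'I_n, (k == m :> nat) &&
    (if k == 0%N :> nat then e k
     else ~~ e (ordpred k) && (e k || D (rank (ordpred k))))].

Lemma DesB_of_std p m : ~~ forbidden (inv_des p) ->
  DesB (of_std p) m = descents (inv_des p) m.
Proof.
move=> hf; case: (ltnP m n) => hm; last first.
  rewrite /DesB ltnNge hm /=; apply/esym/existsP => -[k /andP[/eqP hk _]].
  by have := ltn_ord k; lia.
pose k := Ordinal hm; rewrite -[m]/(nat_of_ord k); clearbody k.
have -> : descents (inv_des p) k = (if k == 0%N :> nat then e k
     else ~~ e (ordpred k) && (e k || inv_des p (rank (ordpred k)))).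
  apply/existsP/idP => [[l /andP[/eqP/ord_inj -> //]]|h].
  by exists k; rewrite eqxx.
have W j : spval (of_std p) j = (if e j then -1 else 1) * Posz ((p^-1)%g (rank j)).+1.
  by rewrite /spval /= permM.
have [k0|k0] := eqVneq (k : nat) 0%N.
  rewrite /DesB ltn_ord wvE [in wv _ _]k0 W /wv /=.
  by case: (e k); lia.
rewrite DesB_ord // !W.
have hk : k = (ordpred k).+1 :> nat by rewrite /= prednK //; lia.
case ek: (e k); case ek': (e (ordpred k)) => /=; try lia; last first.
  rewrite (@inv_des_perm p _ (rank k)); first by lia.
  by apply: rank_succ; rewrite /signed ek ek'; lia.
have hr : rank (ordpred k) = (rank k).+1 :> nat.
  by apply: rank_succ; rewrite /signed ek ek'; lia.
(* Both entries of [w] are negative here; a descent would be an inverse descent between two negative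
   values. *)
have : ~~ inv_des p (rank k).
  apply: contra hf => hd; apply/existsP; exists (rank k); apply/existsP; exists (rank (ordpred k)).
  rewrite hr eqxx hd andbT /=; apply/orP; left; rewrite /level permK /signed ek'; lia.
rewrite (inv_des_perm p hr); lia.
Qed.
End Signs.

(** * Reduction to 321-avoiding permutations *)

Section Reduction.
Variables (n : nat) (R : comNzRingType) (x z : nat -> R) (FC : {set spn n}).
Hypothesis hFC : forall w : spn n, w \in FC <-> fully_commutative w.
Local Open Scope ring_scope.
Implicit Types (e : {ffun 'I_n -> bool}) (p : 'S_n).

(** The value 0 on forbidden sets absorbs the restriction on [p], so that [av321_sym] applies. The
    identity stands in for the permutation since Neg depends on the signs only. *)
Definition desneg_weight e (D : nat -> bool) : R :=
  if forbidden e D then 0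
  else (\prod_(0 <= i < n | descents e D i) x i) * monoNeg z ((1%g, e) : spn n).

Lemma eq_desneg_weight e D D' : D =1 D' -> desneg_weight e D = desneg_weight e D'.
Proof.
move=> E; rewrite /desneg_weight.
have -> : forbidden e D = forbidden e D'.
  by apply: eq_existsb => r; apply: eq_existsb => r'; rewrite E.
case: ifP => // _; congr (_ * _); apply: eq_bigl => i.
by apply: eq_existsb => k; rewrite E.
Qed.

Lemma monoNeg_signs (s s' : 'S_n) e :
  monoNeg z ((s, e) : spn n) = monoNeg z ((s', e) : spn n).
Proof.
rewrite /monoNeg big_nat_cond [RHS]big_nat_cond; apply: eq_bigl => -[//|i].
rewrite /Neg; case: ltnP => //= hi; case: (ltnP i n) => //= hi'.
rewrite -[i]/(nat_of_ord (Ordinal hi')) !wvE /spval /=; case: (e _); lia.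
Qed.

Lemma FC_of_std e p : (of_std e p \in FC) = av321 p && ~~ forbidden e (inv_des p).
Proof.
apply/idP/idP => [/hFC/fully_commutativeP h|h].
  by apply/negPn/negP => /bad_of_std.
by apply/hFC/fully_commutativeP => /bad_of_std; rewrite h.
Qed.

(** [H] is arbitrary so that both sides of the theorem are instances. The sum is split by sign
    vector and each fibre is reindexed by [of_std]. *)
Lemma sum_FC (H : nat -> nat -> R) :
  \sum_(w in FC) monoDes x w * monoNeg z w * H (bl (spinv w)) (n - ldes (spinv w))%N =
  \sum_e \sum_(p | av321 p) desneg_weight e (inv_des p) *
     H (perm_bl p) (n - ldes (spinv (of_std e p)))%N.
Proof.
pose F w := if w \in FC then monoDes x w * monoNeg z w *
   H (bl (spinv w)) (n - ldes (spinv w))%N else 0.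
rewrite big_mkcond -[LHS]/(\sum_w F w).
transitivity (\sum_(s : 'S_n) \sum_e F (s, e)).
  by rewrite pair_bigA; apply: eq_bigr => -[s e].
rewrite exchange_big; apply: eq_bigr => e _.
rewrite (reindex _ (onW_bij _ (of_std_bij e))) [RHS]big_mkcond; apply: eq_bigr => p _.
rewrite /F -[(_, e)]/(of_std e p) FC_of_std /desneg_weight.
case: (av321 p) => //=; case: (boolP (forbidden e (inv_des p))) => [_|hf]; first by rewrite mul0r.
rewrite (bl_perm_bl (lt_inv_of_std e p)) (monoNeg_signs _ 1%g); congr (_ * _ * _).
by apply: eq_bigl => i; rewrite DesB_of_std.
Qed.
End Reduction.

Theorem theorem1p3 (n : nat) (hn : 0 < n) (R : comNzRingType)
    (x z : nat -> R) (q t : R) (FC : {set spn n})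
    (hFC : forall w : spn n, w \in FC <-> fully_commutative w) :
  (\sum_(w in FC) monoDes x w * monoNeg z w
      * q ^+ bl (spinv w) * t ^+ (n - ldes (spinv w)))%R
  = (\sum_(w in FC) monoDes x w * monoNeg z w
      * q ^+ (n - ldes (spinv w)) * t ^+ bl (spinv w))%R.
Proof.
under eq_bigr do rewrite -mulrA.
under [RHS]eq_bigr do rewrite -mulrA.
rewrite (sum_FC x z hFC (fun b l => q ^+ b * t ^+ l)%R).
rewrite (sum_FC x z hFC (fun b l => q ^+ l * t ^+ b)%R).
(* The identity holds for each sign vector separately. *)
apply: eq_bigr => e _.
have := @av321_sym R n q t (fun p => ldes (spinv (of_std e p))) (desneg_weight x z e) hn
  (fun p m => inc_from_ldes m (lt_inv_of_std e p)) (@eq_desneg_weight n R x z e).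
under eq_bigr do rewrite -mulrA.
by under [in X in _ = X -> _]eq_bigr do rewrite -mulrA.
Qed.
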